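(* Let $k$ be a field of characteristic $0$ and let $\Theta$ be the variety of all linear algebras over $k$. Let $\varphi$ be an automorphism of the field $k$ for which there is $\lambda\in k$ with $\varphi(\lambda)\neq\lambda$ and $\varphi(\lambda)\neq\lambda^{-1}$, and fix such a $\lambda$. Let $F=F(x_1,x_2)$ be the free algebra of $\Theta$ on two free generators, let $T$ be the two-sided ideal of $F$ generated by $t=\lambda x_1x_2+x_2x_1$ together with $F^3$, and let $H=F/T$. Let $H^{\ast}_W$ be the algebra with the same underlying set, zero, addition and multiplication as $H$, but with multiplication by scalars given by $\mu\ast h=\varphi(\mu)h$ for $\mu\in k$, $h\in H$. Then $H$ and $H^{\ast}_W$ are not geometrically equivalent.
   Context: A linear algebra over $k$ is a $k$-vector space with a $k$-bilinear multiplication (not assumed associative, commutative or unital); homomorphisms are $k$-linear multiplicative maps, and ''ideal'' means two-sided ideal. $F^j$ denotes the ideal of $F$ spanned by all monomials in the free generators of total degree at least $j$. Let $X_0=\{x_1,x_2,\ldots\}$ be a countable set; for finite $X\subset X_0$ let $F(X)$ be the free algebra of $\Theta$ on $X$. For $H\in\Theta$ and $S\subseteq F(X)$ put $S''_H=\bigcap\{\ker\mu\mid\mu\in\mathrm{Hom}(F(X),H),\ S\subseteq\ker\mu\}$, where $\ker\mu$ is the ideal $\mu^{-1}(0)$. Algebras $H_1,H_2\in\Theta$ are geometrically equivalent if $S''_{H_1}=S''_{H_2}$ for every finite $X\subset X_0$ and every $S\subseteq F(X)$. *)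

(* Defs.v *)
From HB Require Import structures.
From mathcomp Require Import all_boot all_order all_algebra finmap.
From mathcomp Require Import boolp classical_sets.
From mathcomp.multinomials Require Import monalg.

Set Implicit Arguments.
Unset Strict Implicit.
Unset Printing Implicit Defensive.

Import GRing.Theory.
Local Open Scope ring_scope.
Local Open Scope classical_set_scope.
Local Open Scope quotient_scope.

(* The product of a linear algebra is that of [magmaType]: no associativity,
   commutativity or unit. *)

Notation "x ** y" := (x * y)%g (at level 40, left associativity) : ring_scope.

HB.mixin Record Lmodule_isLinAlg (k : pzRingType) A
    of Magma A & GRing.Lmodule k A := {
  lamul_linearl : forall y : A, linear (fun x : A => x ** y);
  lamul_linearr : forall x : A, linear (fun y : A => x ** y)
}.

#[short(type="linAlgType")]
HB.structure Definition LinAlg (k : pzRingType) :=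
  {A of Lmodule_isLinAlg k A & Magma A & GRing.Lmodule k A}.

HB.structure Definition LinAlgHom (k : pzRingType) (A B : linAlgType k) :=
  {f of @Multiplicative A B f & @GRing.Linear k A B *:%R f}.

Notation "{ 'lahom' A -> B }" := (LinAlgHom.type A%type B%type)
  (at level 0, A at level 98, B at level 99,
   format "{ 'lahom'  A  ->  B }") : type_scope.

Section LinAlgTheory.
Variables (k : pzRingType) (A : linAlgType k).
Implicit Types x y z : A.

Lemma lamulDl x y z : (x + y) ** z = x ** z + y ** z.
Proof. by have := lamul_linearl z 1 x y; rewrite !scale1r. Qed.

Lemma lamulDr x y z : x ** (y + z) = x ** y + x ** z.
Proof. by have := lamul_linearr x 1 y z; rewrite !scale1r. Qed.

Lemma lamul0g x : 0 ** x = 0 :> A.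
Proof. by apply: (addrI (0 ** x)); rewrite -lamulDl !addr0. Qed.

Lemma lamulg0 x : x ** 0 = 0 :> A.
Proof. by apply: (addrI (x ** 0)); rewrite -lamulDr !addr0. Qed.

Lemma lamulZl a x y : (a *: x) ** y = a *: (x ** y).
Proof. by have := lamul_linearl y a x 0; rewrite lamul0g !addr0. Qed.

Lemma lamulZr a x y : x ** (a *: y) = a *: (x ** y).
Proof. by have := lamul_linearr x a y 0; rewrite lamulg0 !addr0. Qed.

Lemma lamulBl x y z : (x - y) ** z = x ** z - y ** z.
Proof. by rewrite lamulDl -scaleN1r lamulZl scaleN1r. Qed.

Lemma lamulBr x y z : x ** (y - z) = x ** y - x ** z.
Proof. by rewrite lamulDr -[- z]scaleN1r lamulZr scaleN1r. Qed.

End LinAlgTheory.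

Record is_submodule (k : pzRingType) (V : lmodType k) (S : set V) : Prop := {
  submodule0 : S 0;
  submoduleD : forall x y, S x -> S y -> S (x + y);
  submoduleZ : forall (a : k) x, S x -> S (a *: x)
}.

Record is_ideal (k : pzRingType) (A : linAlgType k) (I : set A) : Prop := {
  ideal_submodule :> is_submodule I;
  idealMl : forall a x, I x -> I (a ** x);
  idealMr : forall a x, I x -> I (x ** a)
}.

Record ideal (k : pzRingType) (A : linAlgType k) :=
  Ideal { ideal_set :> set A; idealP : is_ideal ideal_set }.

Definition lin_span (k : pzRingType) (V : lmodType k) (S : set V) : set V :=
  smallest (@is_submodule k V) S.

Lemma is_ideal_smallest (k : pzRingType) (A : linAlgType k) (S : set A) :
  is_ideal (smallest (@is_ideal k A) S).
Proof.
split; first split.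
- by move=> I [[[]]].
- move=> x y Sx Sy I SI; have [[[_ ID _] _ _] _] := SI.
  by apply: ID; [apply: Sx | apply: Sy].
- by move=> a x Sx I SI; have [[[_ _ IZ] _ _] _] := SI; apply: IZ; apply: Sx.
- by move=> a x Sx I SI; have [[_ IM _] _] := SI; apply: IM; apply: Sx.
- by move=> a x Sx I SI; have [[_ _ IM] _] := SI; apply: IM; apply: Sx.
Qed.

Definition gen_ideal (k : pzRingType) (A : linAlgType k) (S : set A) : ideal A :=
  Ideal (is_ideal_smallest S).

Lemma is_ideal_hom_ker (k : pzRingType) (A B : linAlgType k)
    (f : {lahom A -> B}) :
  is_ideal (f @^-1` [set 0]).
Proof.
split; first split; rewrite /preimage /=.
- exact: linear0.
- by move=> x y /= fx fy; rewrite linearD /= fx fy addr0.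
- by move=> a x /= fx; rewrite linearZ_LR /= fx scaler0.
- by move=> a x /= fx; rewrite gmulfM /= fx lamulg0.
- by move=> a x /= fx; rewrite gmulfM /= fx lamul0g.
Qed.

Definition hom_ker (k : pzRingType) (A B : linAlgType k) (f : {lahom A -> B}) :
  ideal A := Ideal (is_ideal_hom_ker f).

(* The quotient A / I; its additive group is the library's [{quot _}]. *)

Section QuotientAlgebra.
Variables (k : pzRingType) (A : linAlgType k) (I : ideal A).

Definition ideal_pred : A -> bool := fun x => `[< ideal_set I x >].

Lemma ideal_predP x : reflect (ideal_set I x) (x \in ideal_pred).
Proof. exact: asboolP. Qed.

Fact ideal_zmod_closed : zmod_closed ideal_pred.
Proof.
have [[I0 ID IZ] _ _] := idealP I.
split=> [|x y /ideal_predP Ix /ideal_predP Iy]; apply/ideal_predP => //.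
by apply: ID => //; rewrite -scaleN1r; apply: IZ.
Qed.

HB.instance Definition _ := GRing.isZmodClosed.Build A ideal_pred
  ideal_zmod_closed.

Definition quot_alg := Quotient.quot (GRing.ZmodClosed.clone A ideal_pred _).

HB.instance Definition _ := GRing.Zmodule.on quot_alg.
HB.instance Definition _ := EqQuotient.on quot_alg.

Definition quot_scale (a : k) (x : quot_alg) : quot_alg :=
  \pi_quot_alg (a *: repr x).

Definition quot_mul (x y : quot_alg) : quot_alg :=
  \pi_quot_alg (repr x ** repr y).

Lemma quot_eqP (x y : A) : reflect (ideal_set I (x - y))
  (x == y %[mod quot_alg]).
Proof. by rewrite -Quotient.idealrBE; apply: ideal_predP. Qed.

Lemma quot_piD (x y : A) : \pi_quot_alg (x + y) = \pi x + \pi y.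
Proof. exact: (Quotient.pi_add _ x y). Qed.

Lemma quot_reprB (x : A) : ideal_set I (repr (\pi_quot_alg x) - x).
Proof. by apply/quot_eqP; rewrite reprK. Qed.

Lemma quot_piZ a (x : A) : \pi_quot_alg (a *: x) = quot_scale a (\pi x).
Proof.
apply/esym/eqP/quot_eqP; rewrite -scalerBr.
have [[_ _ IZ] _ _] := idealP I; apply: IZ; exact: quot_reprB.
Qed.

Lemma quot_piM (x y : A) :
  \pi_quot_alg (x ** y) = quot_mul (\pi x) (\pi y).
Proof.
apply/esym/eqP/quot_eqP; set x' := repr _; set y' := repr _.
have [[_ ID _] IMl IMr] := idealP I.
have -> : x' ** y' - x ** y = x' ** (y' - y) + (x' - x) ** y.
  by rewrite lamulBl lamulBr addrA subrK.
by apply: ID; [apply: IMl | apply: IMr]; apply: quot_reprB.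
Qed.

Fact quot_scaleA a b x :
  quot_scale a (quot_scale b x) = quot_scale (a * b) x.
Proof.
by rewrite -[x]reprK -(quot_piZ b) -(quot_piZ a) -(quot_piZ (a * b)) scalerA.
Qed.

Fact quot_scale1 : left_id 1 quot_scale.
Proof. by move=> x; rewrite -[x]reprK -(quot_piZ 1) scale1r. Qed.

Fact quot_scaleDr : right_distributive quot_scale +%R.
Proof.
move=> a x y; rewrite -[x]reprK -[y]reprK -quot_piD -(quot_piZ a).
by rewrite scalerDr quot_piD !quot_piZ.
Qed.

Fact quot_scaleDl x : {morph quot_scale^~ x : a b / a + b}.
Proof.
move=> a b; rewrite -[x]reprK -(quot_piZ (a + b)) scalerDl.
by rewrite quot_piD !quot_piZ.
Qed.

HB.instance Definition _ := GRing.Zmodule_isLmodule.Build k quot_alg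
  quot_scaleA quot_scale1 quot_scaleDr quot_scaleDl.

HB.instance Definition _ := hasMul.Build quot_alg quot_mul.

Fact quot_mul_linearl (y : quot_alg) :
  linear (fun x : quot_alg => x ** y).
Proof.
move=> a x x'; rewrite -[x]reprK -[x']reprK -[y]reprK.
have piZ u : a *: \pi_quot_alg u = \pi_quot_alg (a *: u) by rewrite quot_piZ.
have piM u v : \pi_quot_alg u ** \pi_quot_alg v = \pi_quot_alg (u ** v).
  by rewrite quot_piM.
by rewrite piZ -quot_piD !piM lamulDl lamulZl quot_piD -piZ.
Qed.

Fact quot_mul_linearr (x : quot_alg) :
  linear (fun y : quot_alg => x ** y).
Proof.
move=> a y y'; rewrite -[x]reprK -[y]reprK -[y']reprK.
have piZ u : a *: \pi_quot_alg u = \pi_quot_alg (a *: u) by rewrite quot_piZ.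
have piM u v : \pi_quot_alg u ** \pi_quot_alg v = \pi_quot_alg (u ** v).
  by rewrite quot_piM.
by rewrite piZ -quot_piD !piM lamulDr lamulZr quot_piD -piZ.
Qed.

HB.instance Definition _ := Lmodule_isLinAlg.Build k quot_alg
  quot_mul_linearl quot_mul_linearr.

End QuotientAlgebra.

(* A with the same set, addition and multiplication, and with scalars acting
   through phi. *)

Definition twist (k : pzRingType) (phi : {rmorphism k -> k})
  (A : linAlgType k) : Type := A.

Section Twist.
Variables (k : pzRingType) (phi : {rmorphism k -> k}) (A : linAlgType k).
Local Notation twist := (twist phi A).

HB.instance Definition _ := GRing.Zmodule.on twist.
HB.instance Definition _ := Magma.on twist.

Definition twist_scale (a : k) (x : twist) : twist := phi a *: (x : A).

Fact twist_scaleA a b x :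
  twist_scale a (twist_scale b x) = twist_scale (a * b) x.
Proof. by rewrite /twist_scale scalerA rmorphM. Qed.

Fact twist_scale1 : left_id 1 twist_scale.
Proof. by move=> x; rewrite /twist_scale rmorph1 scale1r. Qed.

Fact twist_scaleDr : right_distributive twist_scale +%R.
Proof. by move=> a x y; apply: scalerDr. Qed.

Fact twist_scaleDl x : {morph twist_scale^~ x : a b / a + b}.
Proof. by move=> a b; rewrite /twist_scale rmorphD scalerDl. Qed.

HB.instance Definition _ := GRing.Zmodule_isLmodule.Build k twist
  twist_scaleA twist_scale1 twist_scaleDr twist_scaleDl.

Fact twist_mul_linearl (y : twist) : linear (fun x : twist => x ** y).
Proof. by move=> a x x'; apply: (@lamul_linearl k A y (phi a)). Qed.

Fact twist_mul_linearr (x : twist) : linear (fun y : twist => x ** y).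
Proof. by move=> a y y'; apply: (@lamul_linearr k A x (phi a)). Qed.

HB.instance Definition _ := Lmodule_isLinAlg.Build k twist
  twist_mul_linearl twist_mul_linearr.

End Twist.

(* The free magma on X: its elements are the monomials of F(X). *)

Inductive naword (X : Type) : Type :=
  | Letter of X
  | Prod of naword X & naword X.

Fixpoint degree (X : Type) (w : naword X) : nat :=
  match w with
  | Letter _ => 1
  | Prod u v => degree u + degree v
  end.

Section NaWordChoice.
Variable X : choiceType.

Fixpoint naword_encode (w : naword X) : GenTree.tree X :=
  match w with
  | Letter x => GenTree.Leaf x
  | Prod u v => GenTree.Node 0 [:: naword_encode u; naword_encode v]
  end.

Fixpoint naword_decode (t : GenTree.tree X) : option (naword X) :=
  match t with
  | GenTree.Leaf x => Some (Letter x)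
  | GenTree.Node _ [:: s; t] =>
      match naword_decode s, naword_decode t with
      | Some u, Some v => Some (Prod u v)
      | _, _ => None
      end
  | _ => None
  end.

Lemma naword_encodeK : pcancel naword_encode naword_decode.
Proof. by elim=> //= u -> v ->. Qed.

HB.instance Definition _ := Choice.copy (naword X) (pcan_type naword_encodeK).

End NaWordChoice.

(* F(X) is the magma algebra of the free magma on X. *)

Section FreeAlgebra.
Variables (k : comNzRingType) (X : choiceType).

Definition free_alg := {malg k[naword X]}.

HB.instance Definition _ := GRing.Lmodule.on free_alg.

Definition monomial (w : naword X) : free_alg := << w >>.
Definition free_gen (x : X) : free_alg := monomial (Letter x).

Definition free_mul (f g : free_alg) : free_alg :=
  \sum_(u <- msupp f) \sum_(v <- msupp g)
    (f@_u * g@_v) *: monomial (Prod u v).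

Lemma free_mulw (D E : {fset naword X}) (f g : free_alg) :
    (msupp f `<=` D)%fset -> (msupp g `<=` E)%fset ->
  free_mul f g =
  \sum_(u <- D) \sum_(v <- E) (f@_u * g@_v) *: monomial (Prod u v).
Proof.
move=> fD gE; rewrite /free_mul (big_fset_incl _ fD) /=; last first.
  move=> u _ /mcoeff_outdom fu0.
  by apply: big1 => v _; rewrite fu0 mul0r scale0r.
apply: eq_bigr => u _; rewrite (big_fset_incl _ gE) //.
by move=> v _ /mcoeff_outdom gv0; rewrite gv0 mulr0 scale0r.
Qed.

HB.instance Definition _ := hasMul.Build free_alg free_mul.

Lemma free_mulM (u v : naword X) :
  monomial u ** monomial v = monomial (Prod u v).
Proof.
rewrite [LHS](free_mulw (msuppU_le (k := u)) (msuppU_le (k := v))).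
by rewrite !big_seq_fset1 !mcoeffUU mul1r scale1r.
Qed.

Fact free_mul_linearl (g : free_alg) :
  linear (fun f : free_alg => f ** g).
Proof.
move=> a f f'; set D := (msupp f `|` msupp f' `|` msupp (a *: f + f'))%fset.
have sD : (msupp f `<=` D)%fset by rewrite /D -fsetUA fsubsetUl.
have sD' : (msupp f' `<=` D)%fset by rewrite /D fsetUAC fsubsetUr.
have sD'' : (msupp (a *: f + f') `<=` D)%fset by rewrite fsubsetUr.
have sE := fsubset_refl (msupp g).
rewrite [LHS](free_mulw sD'' sE) [f ** g](free_mulw sD sE).
rewrite [f' ** g](free_mulw sD' sE) scaler_sumr -big_split /=.
apply: eq_bigr => u _; rewrite scaler_sumr -big_split /=.
apply: eq_bigr => v _; rewrite mcoeffD mcoeffZ scalerA -scalerDl.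
by rewrite mulrDl mulrA.
Qed.

Fact free_mul_linearr (f : free_alg) :
  linear (fun g : free_alg => f ** g).
Proof.
move=> a g g'; set D := (msupp g `|` msupp g' `|` msupp (a *: g + g'))%fset.
have sD : (msupp g `<=` D)%fset by rewrite /D -fsetUA fsubsetUl.
have sD' : (msupp g' `<=` D)%fset by rewrite /D fsetUAC fsubsetUr.
have sD'' : (msupp (a *: g + g') `<=` D)%fset by rewrite fsubsetUr.
have sE := fsubset_refl (msupp f).
rewrite [LHS](free_mulw sE sD'') [f ** g](free_mulw sE sD).
rewrite [f ** g'](free_mulw sE sD') scaler_sumr -big_split /=.
apply: eq_bigr => u _; rewrite scaler_sumr -big_split /=.
apply: eq_bigr => v _; rewrite mcoeffD mcoeffZ scalerA -scalerDl.
by rewrite mulrDr mulrCA.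
Qed.

HB.instance Definition _ := Lmodule_isLinAlg.Build k free_alg
  free_mul_linearl free_mul_linearr.

Definition free_pow_set (j : nat) : set free_alg :=
  lin_span [set monomial w | w in [set w | (j <= degree w)%N]].

Lemma free_algE (f : free_alg) : f = \sum_(u <- msupp f) f@_u *: monomial u.
Proof.
rewrite {1}[f]monalgE; apply: eq_bigr => u _.
by apply/malgP => v; rewrite mcoeffZ !mcoeffU mulrnAr mulr1.
Qed.

Lemma is_ideal_free_pow_set j : is_ideal (free_pow_set j).
Proof.
have sub : is_submodule (free_pow_set j).
  split=> [S [[]//]|f g Sf Sg S SI|a f Sf S SI]; have [[_ SD SZ] _] := SI.
  - by apply: SD; [apply: Sf | apply: Sg].
  - by apply: SZ; apply: Sf.
have genP w : (j <= degree w)%N -> free_pow_set j (monomial w).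
  by move=> jw; apply: sub_gen_smallest; exists w.
have [S0 SD SZ] := sub.
split=> // a f; apply: (smallest_sub (X := [set f | _])) => /=.
- split=> [|g h Sg Sh|b g Sg] /=; first by rewrite lamulg0.
  + by rewrite lamulDr; apply: SD.
  + by rewrite lamulZr; apply: SZ.
- move=> _ [w /= jw <-]; rewrite [a]free_algE.
  elim/big_rec: _ => [|u g _ Sg]; first by rewrite lamul0g.
  rewrite lamulDl lamulZl free_mulM; apply: SD => //; apply: SZ; apply: genP.
  by apply: (leq_trans jw); apply: leq_addl.
- split=> [|g h Sg Sh|b g Sg] /=; first by rewrite lamul0g.
  + by rewrite lamulDl; apply: SD.
  + by rewrite lamulZl; apply: SZ.
- move=> _ [w /= jw <-]; rewrite [a]free_algE.
  elim/big_rec: _ => [|u g _ Sg]; first by rewrite lamulg0.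
  rewrite lamulDr lamulZr free_mulM; apply: SD => //; apply: SZ; apply: genP.
  by apply: (leq_trans jw); apply: leq_addr.
Qed.

Definition free_pow (j : nat) : ideal free_alg :=
  Ideal (is_ideal_free_pow_set j).

End FreeAlgebra.

Arguments free_pow k X j : clear implicits.

(* The variables x_1, x_2, ... are indexed by nat, and [free_alg k X] below is
   the free algebra on the finite type of elements of X : {fset nat}.
   [closure_in H S] is S''_H. *)

Definition closure_in (k : fieldType) (X : {fset nat}) (H : linAlgType k)
    (S : set (free_alg k X)) : set (free_alg k X) :=
  \bigcap_(mu in [set mu : {lahom free_alg k X -> H} | S `<=` hom_ker mu])
    hom_ker mu.

Definition geom_equiv (k : fieldType) (H1 H2 : linAlgType k) : Prop :=
  forall (X : {fset nat}) (S : set (free_alg k X)),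
    closure_in H1 S = closure_in H2 S.

Section TheAlgebraH.
Variables (k : fieldType) (lam : k).

Local Notation F := (free_alg k 'I_2).
Local Notation x1 := (free_gen k (ord0 : 'I_2)).
Local Notation x2 := (free_gen k (ord_max : 'I_2)).

Definition t_rel : F := lam *: (x1 ** x2) + x2 ** x1.

Definition T_ideal : ideal F := gen_ideal ([set t_rel] `|` free_pow k 'I_2 3).

Definition H_alg : linAlgType k := quot_alg T_ideal.

End TheAlgebraH.

(* Main.v *)
(** The relation s = lam x y + y x separates the two algebras. In the twisted
    algebra its scalar acts as phi(lam), which differs from lam, lam^-1 and -1.
    Comparing the degree 2 coefficients, phi(lam) a b + b a = 0 then forces the
    linear part of a or of b to vanish, so that a b lies in F^3 modulo T and is
    zero: x y belongs to the closure of s. In H itself x |-> x_1, y |-> x_2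
    kills s but not x y. *)

From HB Require Import structures.
Require Import Defs.
From mathcomp Require Import all_boot all_order all_algebra finmap ring.
From mathcomp Require Import boolp classical_sets.
From mathcomp.multinomials Require Import monalg.

Set Implicit Arguments.
Unset Strict Implicit.
Unset Printing Implicit Defensive.

Import GRing.Theory.
Local Open Scope ring_scope.
Local Open Scope classical_set_scope.
Local Open Scope quotient_scope.

(** * Coefficients of products in the free algebra *)

Section FreeAlgebra.
Variables (k : comNzRingType) (X : choiceType).
Local Notation F := (free_alg k X).

Lemma free_alg_ind (S : set F) :
  is_submodule S -> (forall w, S (monomial k w)) -> forall f, S f.
Proof.
move=> [S0 SD SZ] Sw f; rewrite [f]free_algE.
by elim/big_rec: _ => // u g _ Sg; apply: SD => //; apply: SZ.
Qed.

Lemma mcoeff_monomial (u w : naword X) : (monomial k u)@_w = (u == w)%:R.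
Proof. by rewrite [LHS]mcoeffU. Qed.

(** Monomials span [F], so linearity is applied in one argument and then in the other. This reduces
    the product formulas and the multiplicativity of [free_lift] to a check on words. *)
Lemma bilinear_eq (V : lmodType k) (B C : F -> F -> V) :
    (forall g, linear (B^~ g)) -> (forall f, linear (B f)) ->
    (forall g, linear (C^~ g)) -> (forall f, linear (C f)) ->
    (forall u v, B (monomial k u) (monomial k v)
               = C (monomial k u) (monomial k v)) ->
  forall f g, B f g = C f g.
Proof.
have linear_eq (h h' : F -> V) : linear h -> linear h' ->
    (forall u, h (monomial k u) = h' (monomial k u)) -> forall f, h f = h' f.
  move=> hl hl' hh'; apply: free_alg_ind => //; split=> [|f g hf hg|a f hf].
  (* Linearity at scalar [-1] and zero vectors gives [h 0 = - h 0 + h 0 = 0]. *)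
  - by have := hl (-1) 0 0; have := hl' (-1) 0 0;
      rewrite !scaleN1r oppr0 addr0 !addNr => -> ->.
  - by have := hl 1 f g; have := hl' 1 f g; rewrite !scale1r hf hg => -> ->.
  - rewrite -[a *: f]addr0 hl hl' hf; congr (_ + _).
    by have := hl (-1) 0 0; have := hl' (-1) 0 0;
      rewrite !scaleN1r oppr0 addr0 !addNr => -> ->.
move=> Bl Br Cl Cr BC f g; apply: (linear_eq (B^~ g) (C^~ g)) => // u.
by apply: (linear_eq (B _) (C _)).
Qed.

(** A product of two words is a [Prod], never a letter. *)
Lemma mcoeff_letterM (f g : F) x : (f ** g)@_(Letter x) = 0.
Proof.
move: f g; apply: (@bilinear_eq k^o (fun f g => (f ** g)@_(Letter x))
  (fun _ _ => 0)) => [g|f|g|f|u v] /=; rewrite ?free_mulM ?mcoeff_monomial //.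
- by move=> a f f'; rewrite [_ ** g]free_mul_linearl mcoeffD mcoeffZ.
- by move=> a g g'; rewrite [f ** _]free_mul_linearr mcoeffD mcoeffZ.
- by move=> a ? ?; rewrite scaler0 addr0.
- by move=> a ? ?; rewrite scaler0 addr0.
Qed.

(** Words factor uniquely in the free magma, so [Prod u v] arises only from the pair of [u] and [v];
    no sum over factorizations appears. *)
Lemma mcoeff_ProdM (f g : F) u v : (f ** g)@_(Prod u v) = f@_u * g@_v.
Proof.
move: f g; apply: (@bilinear_eq k^o (fun f g => (f ** g)@_(Prod u v))
  (fun f g => f@_u * g@_v)) => [g|f|g|f|p q] /=.
- by move=> a f f'; rewrite [_ ** g]free_mul_linearl mcoeffD mcoeffZ.
- by move=> a g g'; rewrite [f ** _]free_mul_linearr mcoeffD mcoeffZ.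
- by move=> a f f'; rewrite mcoeffD mcoeffZ mulrDl -mulrA.
- by move=> a g g'; rewrite mcoeffD mcoeffZ mulrDr mulrCA.
rewrite free_mulM !mcoeff_monomial -natrM mulnb; congr (_ %:R).
by congr nat_of_bool; apply/eqP/andP => [[-> ->]|[/eqP-> /eqP->]].
Qed.

Lemma mcoeff_genM (x y : X) (w : naword X) :
  (free_gen k x ** free_gen k y)@_w = (Prod (Letter x) (Letter y) == w)%:R.
Proof. by rewrite /free_gen free_mulM; apply: mcoeff_monomial. Qed.

Lemma mcoeff_t_rel (c : k) (x y : X) (w : naword X) :
  (c *: (free_gen k x ** free_gen k y) + free_gen k y ** free_gen k x)@_w =
  c * (Prod (Letter x) (Letter y) == w)%:R +
  (Prod (Letter y) (Letter x) == w)%:R.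
Proof. by rewrite mcoeffD mcoeffZ; congr (_ * _ + _); apply: mcoeff_genM. Qed.

Lemma mcoeff_swap_relation (c : k) (f g : F) u v :
  (c *: (f ** g) + g ** f)@_(Prod u v) = c * (f@_u * g@_v) + g@_u * f@_v.
Proof. by rewrite mcoeffD mcoeffZ; congr (_ * _ + _); apply: mcoeff_ProdM. Qed.

(** * The degree filtration of the free algebra *)

Lemma free_pow_monomial j (w : naword X) :
  (j <= degree w)%N -> free_pow_set j (monomial k w).
Proof. by move=> jw; apply: sub_gen_smallest; exists w. Qed.

Lemma degree_gt0 (w : naword X) : (0 < degree w)%N.
Proof. by elim: w => //= u hu v hv; rewrite addn_gt0 hu. Qed.

Lemma free_pow1 (f : F) : free_pow_set 1 f.
Proof.
apply: free_alg_ind => [|w]; first by case: (idealP (free_pow k X 1)).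
by apply: free_pow_monomial; apply: degree_gt0.
Qed.

(** A word that is not a letter is a product of two words of positive degree, so its degree is at
    least 2. *)
Lemma free_pow2 (f : F) : (forall x, f@_(Letter x) = 0) -> free_pow_set 2 f.
Proof.
move=> f0; have [[S0 SD SZ] _ _] := idealP (free_pow k X 2).
rewrite [f]free_algE; elim/big_rec: _ => // u g _ Sg; apply: SD => //.
case: u => [x|u v]; first by rewrite f0 scale0r.
apply: SZ; apply: free_pow_monomial => /=.
by rewrite (leq_add (degree_gt0 u) (degree_gt0 v)).
Qed.

Lemma is_submodule_preimage (U V : lmodType k) (h : U -> V) (S : set V) :
  linear h -> is_submodule S -> is_submodule (h @^-1` S).
Proof.
move=> hl [S0 SD SZ].
have h0 : h 0 = 0.
  by have := hl (-1) 0 0; rewrite !scaleN1r oppr0 addr0 addNr.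
split=> [|x y hx hy|a x hx] /=; first by rewrite /preimage /= h0.
- by rewrite /preimage /= -[x]scale1r hl scale1r; apply: SD.
- by rewrite /preimage /= -[a *: x]addr0 hl h0 addr0; apply: SZ.
Qed.

(** For a fixed second factor, the admissible first factors form a submodule, so monomials suffice;
    the same argument then treats the second factor. On monomials degrees add. *)
Lemma free_powM i j (f g : F) :
  free_pow_set i f -> free_pow_set j g -> free_pow_set (i + j) (f ** g).
Proof.
have [sub _ _] := idealP (free_pow k X (i + j)).
move=> fi gj; move: f fi.
apply: (@smallest_sub _ _ _ ((fun f : F => f ** g) @^-1` free_pow_set (i + j))).
  exact: is_submodule_preimage (free_mul_linearl g) sub.
move=> _ [u /= iu <-]; rewrite /preimage /=; move: g gj.
apply: (@smallest_sub _ _ _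
  ((fun g : F => monomial k u ** g) @^-1` free_pow_set (i + j))).
  exact: is_submodule_preimage (free_mul_linearr _) sub.
move=> _ [v /= jv <-]; rewrite /preimage /= free_mulM.
by apply: free_pow_monomial; apply: leq_add.
Qed.

(** * Universal property of the free algebra *)

Variables (A : linAlgType k) (v : X -> A).

Fixpoint word_eval (w : naword X) : A :=
  match w with
  | Letter x => v x
  | Prod u w => word_eval u ** word_eval w
  end.

Definition free_lift (f : F) : A := \sum_(u <- msupp f) f@_u *: word_eval u.

(** Words outside the support contribute zero; enlarging the index set allows [f], [g] and
    [a *: f + g] to be summed over one common set. *)
Lemma free_liftw (D : {fset naword X}) (f : F) :
  (msupp f `<=` D)%fset ->
  free_lift f = \sum_(u <- D) f@_u *: word_eval u.
Proof.
move=> fD; rewrite /free_lift (big_fset_incl _ fD) // => u _ /mcoeff_outdom ->.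
by rewrite scale0r.
Qed.

Fact free_lift_linear : linear free_lift.
Proof.
move=> a f g; set D := (msupp f `|` msupp g `|` msupp (a *: f + g))%fset.
have sf : (msupp f `<=` D)%fset by rewrite /D -fsetUA fsubsetUl.
have sg : (msupp g `<=` D)%fset by rewrite /D fsetUAC fsubsetUr.
have sh : (msupp (a *: f + g) `<=` D)%fset by rewrite fsubsetUr.
rewrite (free_liftw sf) (free_liftw sg) (free_liftw sh).
rewrite scaler_sumr -big_split /=; apply: eq_bigr => u _.
by rewrite mcoeffD mcoeffZ scalerDl scalerA.
Qed.

HB.instance Definition _ :=
  GRing.isLinear.Build k F A *:%R free_lift free_lift_linear.

Lemma free_lift_monomial (w : naword X) :
  free_lift (monomial k w) = word_eval w.
Proof.
rewrite (free_liftw (msuppU_le (k := w))) big_seq_fset1 mcoeffUU.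
by rewrite scale1r.
Qed.

Fact free_lift_mul : {morph free_lift : f g / (f * g)%g}.
Proof.
apply: bilinear_eq => [g|f|g|f|p q] /=.
- by move=> a f f'; rewrite [_ ** g]free_mul_linearl linearP.
- by move=> a g g'; rewrite [f ** _]free_mul_linearr linearP.
- by move=> a f f'; rewrite linearP lamulDl lamulZl.
- by move=> a g g'; rewrite linearP lamulDr lamulZr.
rewrite free_mulM [LHS]free_lift_monomial; congr (_ ** _);
  exact/esym/free_lift_monomial.
Qed.

HB.instance Definition _ :=
  monoid.isMultiplicative.Build F A free_lift free_lift_mul.

Lemma free_lift_gen (x : X) : free_lift (free_gen k x) = v x.
Proof. exact: free_lift_monomial. Qed.

End FreeAlgebra.

(** * Homomorphisms and the quotient map *)

Lemma lahom_swap_relation (k : pzRingType) (A B : linAlgType k)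
    (mu : {lahom A -> B}) (c : k) (x y : A) :
  mu (c *: (x ** y) + y ** x) = c *: (mu x ** mu y) + mu y ** mu x.
Proof. by rewrite linearD linearZ_LR !gmulfM. Qed.

Lemma lahomM (k : pzRingType) (A B : linAlgType k) (mu : {lahom A -> B})
    (x y : A) : mu (x ** y) = mu x ** mu y.
Proof. exact: gmulfM. Qed.

Section QuotientMap.
Variables (k : pzRingType) (A : linAlgType k) (I : ideal A).

Definition quot_map (x : A) : quot_alg I := \pi_(quot_alg I) x.

Lemma quot_mapD x y : quot_map (x + y) = quot_map x + quot_map y.
Proof. exact: quot_piD. Qed.

Lemma quot_mapZ a x : quot_map (a *: x) = a *: quot_map x.
Proof. exact: quot_piZ. Qed.

Lemma quot_mapM x y : quot_map (x ** y) = quot_map x ** quot_map y.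
Proof. exact: quot_piM. Qed.

Lemma quot_map_swap_relation (c : k) x y :
  quot_map (c *: (x ** y) + y ** x) =
  c *: (quot_map x ** quot_map y) + quot_map y ** quot_map x.
Proof. by rewrite quot_mapD quot_mapZ !quot_mapM. Qed.

Lemma quot_map_eq0 x : quot_map x = 0 <-> ideal_set I x.
Proof.
have pi0 : quot_map 0 = 0.
  by apply: (addrI (quot_map 0)); rewrite -quot_mapD !addr0.
rewrite -[x in X in _ <-> X]subr0; split=> [fT|fT].
  by apply/quot_eqP; rewrite -!/(quot_map _) fT pi0.
by rewrite -pi0; apply/eqP/quot_eqP.
Qed.

Lemma quot_map_surj (a : quot_alg I) : exists x, a = quot_map x.
Proof. by exists (repr a); rewrite /quot_map reprK. Qed.

End QuotientMap.

(** * The ideal T and vanishing products in H *)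

Section TheAlgebraH.
Variables (k : fieldType) (lam : k).
Local Notation F := (free_alg k 'I_2).
Local Notation l1 := (Letter (ord0 : 'I_2)).
Local Notation l2 := (Letter (ord_max : 'I_2)).

(* These equations in fact cut out exactly [T_ideal lam]. *)
Definition T_coeff (f : F) : Prop :=
  [/\ forall x, f@_(Letter x) = 0, f@_(Prod l1 l1) = 0, f@_(Prod l2 l2) = 0
    & f@_(Prod l1 l2) = lam * f@_(Prod l2 l1)].

(** For products, letter coefficients always vanish, and each degree 2 coefficient is a product of
    letter coefficients, one of which is zero. *)
Lemma is_ideal_T_coeff : is_ideal T_coeff.
Proof.
split; first split.
- by split=> [x|||]; rewrite !mcoeff0 ?mulr0.
- move=> f g [f0 f1 f2 f3] [g0 g1 g2 g3].
  split=> [x|||]; rewrite !mcoeffD ?f0 ?g0 ?f1 ?g1 ?f2 ?g2 ?f3 ?g3 ?addr0 //.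
  by rewrite mulrDr.
- move=> a f [f0 f1 f2 f3].
  split=> [x|||]; rewrite !mcoeffZ ?f0 ?f1 ?f2 ?f3 ?mulr0 //; exact: mulrCA.
- move=> a f [f0 _ _ _].
  by split=> [x|||]; rewrite ?mcoeff_letterM ?mcoeff_ProdM ?f0 ?mulr0.
- move=> a f [f0 _ _ _].
  by split=> [x|||]; rewrite ?mcoeff_letterM ?mcoeff_ProdM ?f0 ?(mul0r, mulr0).
Qed.

(** It suffices to test the generators: [t_rel] has coefficient [lam] at [x1 ** x2] and 1 at
    [x2 ** x1], and words of degree at least 3 do not meet the equations. *)
Lemma T_ideal_coeff (f : F) : ideal_set (T_ideal lam) f -> T_coeff f.
Proof.
move: f; apply: smallest_sub => [|f [->|]]; first exact: is_ideal_T_coeff.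
  have tE w : (t_rel lam)@_w =
      lam * (Prod l1 l2 == w)%:R + (Prod l2 l1 == w)%:R.
    exact: mcoeff_t_rel.
  by split=> [x|||]; rewrite !tE ?(mulr0, mulr1, addr0, add0r).
move: f; apply: smallest_sub => [|_ [w /= w3 <-]].
  by case: is_ideal_T_coeff.
have nw u : (degree u <= 2)%N -> (monomial k w)@_u = 0.
  move=> u2; rewrite mcoeff_monomial; case: eqP => // wu.
  by move: (leq_ltn_trans u2 w3); rewrite wu ltnn.
by split=> [x|||]; rewrite !nw ?mulr0.
Qed.

Lemma T_ideal_t : ideal_set (T_ideal lam) (t_rel lam).
Proof. by apply: sub_gen_smallest; left. Qed.

Lemma T_ideal_pow3 (f : F) : free_pow_set 3 f -> ideal_set (T_ideal lam) f.
Proof. by move=> f3; apply: sub_gen_smallest; right. Qed.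

(** With [fi], [gi] the letter coefficients, the hypothesis becomes [(c + 1) f1 g1 = 0],
    [(c + 1) f2 g2 = 0] and [(c - lam) f1 g2 = (lam c - 1) f2 g1]. The three conditions on [c] make
    all these scalar factors nonzero. *)
Lemma T_coeff_relation (c : k) (f g : F) :
    c != lam -> c != lam^-1 -> c != -1 ->
    T_coeff (c *: (f ** g) + g ** f) ->
  (forall x, f@_(Letter x) = 0) \/ (forall x, g@_(Letter x) = 0).
Proof.
move=> c_lam c_lamV c_N1 [_ T11 T22 T12].
have M := mcoeff_swap_relation c f g.
have e11 := etrans (esym (M l1 l1)) T11.
have e22 := etrans (esym (M l2 l2)) T22.
have e12 := etrans (esym (M l1 l2)) (etrans T12 (congr1 _ (M l2 l1))).
move: e11 e22 e12.
set f1 := f@_l1; set f2 := f@_l2; set g1 := g@_l1; set g2 := g@_l2.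
move=> e11 e22 e12.
have ind2 (h : F) : h@_l1 = 0 -> h@_l2 = 0 -> forall x, h@_(Letter x) = 0.
  move=> h1 h2 [[|[|//]] x2]; [rewrite -[RHS]h1|rewrite -[RHS]h2];
  by congr (h@_(Letter _)); apply: val_inj.
have c1 : c + 1 != 0 by rewrite addr_eq0.
have cl : c - lam != 0 by rewrite subr_eq0.
have lc : lam * c - 1 != 0.
  rewrite subr_eq0; apply: contra c_lamV => /eqP lc1.
  by apply/eqP; rewrite (mulr1_eq lc1).
have /eqP : (c + 1) * (f1 * g1) = 0 by rewrite -e11; ring.
have /eqP : (c + 1) * (f2 * g2) = 0 by rewrite -e22; ring.
have : (c - lam) * (f1 * g2) = (lam * c - 1) * (f2 * g1).
  by apply/eqP; rewrite -subr_eq0; move/eqP: e12; rewrite -subr_eq0 => /eqP<-;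
     apply/eqP; ring.
rewrite !mulf_eq0 !(negPf c1) /=.
(* If [f1] and [f2] are both nonzero, the two diagonal equations kill [g1] and [g2]. If exactly one
   is nonzero, its diagonal equation kills one [gi], and the mixed equation, having lost one side,
   kills the other. *)
have [f10|f1N0] := eqVneq f1 0; have [f20|f2N0] := eqVneq f2 0.
- by left; apply: ind2.
- rewrite f10 mul0r mulr0 => /esym/eqP; rewrite !mulf_eq0 (negPf lc).
  rewrite (negPf f2N0) /= => /eqP g10 /eqP g20 _; by right; apply: ind2.
- rewrite f20 mul0r mulr0 => /eqP; rewrite !mulf_eq0 (negPf cl).
  rewrite (negPf f1N0) /= => /eqP g20 _ /eqP g10; by right; apply: ind2.
- by move=> _ /eqP g20 /eqP g10; right; apply: ind2.
Qed.

(** On representatives, one factor has no linear part and so lies in [F^2], while the other lies in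
    [F^1]; their product is in [F^3], hence in T. *)
Lemma H_mul_eq0 (c : k) (a b : H_alg lam) :
  c != lam -> c != lam^-1 -> c != -1 ->
  c *: (a ** b) + b ** a = 0 -> a ** b = 0.
Proof.
move=> c_lam c_lamV c_N1.
have [f ->] := quot_map_surj a; have [g ->] := quot_map_surj b.
move/(etrans (quot_map_swap_relation _ c f g))/quot_map_eq0/T_ideal_coeff.
move=> /(T_coeff_relation c_lam c_lamV c_N1) fg0.
apply: etrans (esym (quot_mapM _ f g)) _.
apply/quot_map_eq0; apply: T_ideal_pow3.
case: fg0 => [/free_pow2 f2|/free_pow2 g2].
  exact: (free_powM f2 (free_pow1 g)).
exact: (free_powM (free_pow1 f) g2).
Qed.

End TheAlgebraH.

Theorem proposition5p2 (k : fieldType) (phi : {rmorphism k -> k}) (lam : k)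
    (char_k : [pchar k] =i pred0) (phi_bij : bijective phi)
    (phi_lam : phi lam != lam) (phi_lamV : phi lam != lam^-1) :
  ~ geom_equiv (H_alg lam) (twist phi (H_alg lam)).
Proof.
pose X := [fset 0%N; 1%N]%fset.
pose p : X := [` fset21 0%N 1%N]%fset; pose q : X := [` fset22 0%N 1%N]%fset.
pose x := free_gen k p; pose y := free_gen k q.
pose s : free_alg k X := lam *: (x ** y) + y ** x.
move=> /(_ X [set s]) eqS.
(* As [phi] fixes [-1] and is injective, [phi lam = -1] would force [lam = -1 = phi lam]. *)
have phi_N1 : phi lam != -1.
  apply: contra phi_lam => /eqP phi_lam; apply/eqP.
  by rewrite phi_lam; apply: (fmorph_inj phi); rewrite phi_lam rmorphN1.
have xy_closure : closure_in (twist phi (H_alg lam)) [set s] (x ** y).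
  move=> mu mus; apply: etrans (lahomM mu x y) _.
  (* Scaling by [lam] in the twist is, by definition, scaling by [phi lam] in H, so [mu s = 0] is
     the relation in H with [c = phi lam]. *)
  apply: (@H_mul_eq0 k lam (phi lam)) => //.
  exact: etrans (esym (lahom_swap_relation mu lam x y)) (mus s erefl).
(* [X] has only the elements [p] and [q], so [v] sends [p] to the class of [x1] and [q] to that of
   [x2]; the image of [s] is then the class of [t_rel]. *)
pose v (i : X) : H_alg lam := quot_map (T_ideal lam)
  (free_gen k (if i == p then ord0 else ord_max : 'I_2)).
pose mu : {lahom free_alg k X -> H_alg lam} := free_lift v.
have mux : mu x = quot_map (T_ideal lam) (free_gen k ord0).
  exact: free_lift_gen.
have muy : mu y = quot_map (T_ideal lam) (free_gen k ord_max).
  exact: free_lift_gen.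
have mus : [set s] `<=` hom_ker mu.
  move=> _ ->; apply: etrans (lahom_swap_relation mu lam x y) _.
  pose R (a b : H_alg lam) := lam *: (a ** b) + b ** a.
  apply: etrans (f_equal2 R mux muy) _.
  apply: etrans (esym (quot_map_swap_relation _ _ _ _)) _.
  by apply/quot_map_eq0; apply: T_ideal_t.
move: xy_closure; rewrite -eqS => /(_ mu mus) muxy.
have : quot_map (T_ideal lam)
    (free_gen k (ord0 : 'I_2) ** free_gen k (ord_max : 'I_2)) = 0.
  pose M (a b : H_alg lam) := a ** b.
  apply: etrans (quot_mapM _ _ _) _.
  apply: etrans (esym (f_equal2 M mux muy)) _.
  exact: etrans (esym (lahomM mu x y)) muxy.
(* Were [x1 ** x2] in T, its coefficients 1 at [x1 ** x2] and 0 at [x2 ** x1] would give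
   [1 = lam * 0]. *)
move=> /quot_map_eq0/T_ideal_coeff[_ _ _ e12].
have M := mcoeff_genM k (ord0 : 'I_2) ord_max.
have /eqP := etrans (esym (M _)) (etrans e12 (congr1 _ (M _))).
by rewrite mulr0 oner_eq0.
Qed.
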